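(* Let $\boldsymbol{\beta}=(\beta_n)_{n\in\mathbb N}$ be a Cantor base. An infinite word $a$ over $\mathbb N$ belongs to $D_{\boldsymbol{\beta}}$ if and only if for all $n\in\mathbb N$, $\sigma^n(a)<_{\mathrm{lex}} d^*_{\boldsymbol{\beta}^{(n)}}(1)$.
   Context: A Cantor base is a sequence $\boldsymbol{\beta}=(\beta_n)_{n\in\mathbb N}$ of real numbers greater than $1$ with $\prod_{n\in\mathbb N}\beta_n=+\infty$. For $n\in\mathbb N$, $\boldsymbol{\beta}^{(n)}=(\beta_n,\beta_{n+1},\ldots)$ (also a Cantor base). For an infinite word $a=a_0a_1\cdots$ over $\mathbb R_{\ge0}$, $\mathrm{val}_{\boldsymbol{\beta}}(a)=\sum_{n\in\mathbb N}\frac{a_n}{\prod_{i=0}^n\beta_i}$ whenever the series converges; a $\boldsymbol{\beta}$-representation of $x\ge 0$ is an infinite word $a$ over $\mathbb N$ with $\mathrm{val}_{\boldsymbol{\beta}}(a)=x$. $\sigma$ is the shift $a_0a_1a_2\cdots\mapsto a_1a_2\cdots$, and $<_{\mathrm{lex}}$ is the lexicographic order on infinite words over $\mathbb N$. Greedy algorithm: for $x\in[0,1]$, set $r_{-1}(x)=x$ and for $n\ge0$, $\varepsilon_n(x)=\lfloor\beta_n r_{n-1}(x)\rfloor$, $r_n(x)=\beta_nr_{n-1}(x)-\varepsilon_n(x)$; the $\boldsymbol{\beta}$-expansion of $x$ is $d_{\boldsymbol{\beta}}(x)=\varepsilon_0(x)\varepsilon_1(x)\cdots$. $D_{\boldsymbol{\beta}}=\{d_{\boldsymbol{\beta}}(x)\colon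 x\in[0,1)\}$. A word is finite if it ends with $0^\omega$, infinite otherwise. The quasi-greedy expansion of $1$ is defined recursively: $d^*_{\boldsymbol{\beta}}(1)=d_{\boldsymbol{\beta}}(1)$ if $d_{\boldsymbol{\beta}}(1)$ is infinite, and if $d_{\boldsymbol{\beta}}(1)=\varepsilon_0\cdots\varepsilon_{\ell-1}0^\omega$ with $\ell\ge1$ and $\varepsilon_{\ell-1}>0$, then $d^*_{\boldsymbol{\beta}}(1)=\varepsilon_0\cdots\varepsilon_{\ell-2}(\varepsilon_{\ell-1}-1)\,d^*_{\boldsymbol{\beta}^{(\ell)}}(1)$ (if the recursion never stops, $d^*_{\boldsymbol{\beta}}(1)$ is the infinite word obtained as the limit of the concatenated prefixes). *)

(* Defs.v *)
From HB Require Import structures.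
From mathcomp Require Import all_boot all_order all_algebra.
From mathcomp Require Import all_classical all_reals all_analysis.

Set Implicit Arguments.
Unset Strict Implicit.
Unset Printing Implicit Defensive.

Import Order.TTheory GRing.Theory Num.Theory.
Import numFieldNormedType.Exports.

Local Open Scope classical_set_scope.
Local Open Scope ring_scope.

Definition cantor_base (R : realType) (beta : nat -> R) : Prop :=
  (forall n, 1 < beta n) /\ \prod_(i < n) beta i @[n --> \oo] --> +oo.

(* Used both for the shifted base beta^(n) and for the shifted word sigma^n(a). *)
Definition shiftn (T : Type) (n : nat) (u : nat -> T) : nat -> T :=
  fun i => u (n + i)%N.

Definition lex_lt (u v : nat -> nat) : Prop :=
  exists n, (forall i, (i < n)%N -> u i = v i) /\ (u n < v n)%N.

(* Indices are off by one: [remainder beta x n] is the remainder r_(n-1)(x),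
   so that r_(-1)(x) = x is [remainder beta x 0]. *)
Fixpoint remainder (R : realType) (beta : nat -> R) (x : R) (n : nat) : R :=
  if n is m.+1 then
    beta m * remainder beta x m
    - (Num.floor (beta m * remainder beta x m))%:~R
  else x.

(* The digits are natural numbers: the floor is taken by [Num.truncn], which
   agrees with [Num.floor] on the nonnegative reals, hence for x in [0, 1]. *)
Definition expansion (R : realType) (beta : nat -> R) (x : R) : nat -> nat :=
  fun n => Num.truncn (beta n * remainder beta x n).

Definition expansions (R : realType) (beta : nat -> R) : set (nat -> nat) :=
  [set expansion beta x | x in [set x : R | 0 <= x < 1]].

Definition finite_word (w : nat -> nat) : Prop :=
  exists l, forall n, (l <= n)%N -> w n = 0%N.

(* w = w_0 ... w_(l-1) 0^omega with l >= 1 and w_(l-1) > 0. *)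
Definition has_length (w : nat -> nat) (l : nat) : Prop :=
  [/\ (0 < l)%N, (0 < w l.-1)%N & forall n, (l <= n)%N -> w n = 0%N].

Definition word_length (w : nat -> nat) : nat :=
  xget 0%N [set l | has_length w l].

(* The recursion for the quasi-greedy expansion of 1, unfolded at most k times
   and cut off by 0^omega. *)
Fixpoint quasi_greedy_approx (R : realType) (k : nat) (beta : nat -> R) :
    nat -> nat :=
  if k is k'.+1 then
    let e := expansion beta 1 in
    if `[< finite_word e >] then
      let l := word_length e in
      fun n =>
        if (n < l.-1)%N then e n
        else if n == l.-1 then (e n).-1
        else quasi_greedy_approx k' (shiftn l beta) (n - l)
    else e
  else fun=> 0%N.

(* Each unfolding settles at least one more letter, so that letter n no longer
   changes after n + 1 unfoldings; [quasi_greedy_infinite] and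
   [quasi_greedy_finite] below are the two clauses of the recursion. *)
Definition quasi_greedy (R : realType) (beta : nat -> R) : nat -> nat :=
  fun n => quasi_greedy_approx n.+1 beta n.

Lemma has_length_uniq w l l' : has_length w l -> has_length w l' -> l = l'.
Proof.
move=> [l0 wl lz] [l'0 wl' l'z].
case: (ltngtP l l') => // [ll'|l'l].
- by move: wl'; rewrite lz // -ltnS prednK.
- by move: wl; rewrite l'z // -ltnS prednK.
Qed.

Lemma word_lengthE w l : has_length w l -> word_length w = l.
Proof.
by move=> wl; apply: (@has_length_uniq w) => //; apply: (@xgetI _ 0%N _ l wl).
Qed.

Lemma finite_has_length w n :
  (0 < w n)%N -> finite_word w -> exists l, has_length w l.
Proof.
move=> wn [m]; elim: m => [|m IH] mz; first by move: wn; rewrite mz.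
case: (posnP (w m)) => [wm|wm]; last by exists m.+1.
by apply: IH => i; rewrite leq_eqVlt => /predU1P[<-//|]; apply: mz.
Qed.

Lemma has_length_finite w l : has_length w l -> finite_word w.
Proof. by move=> [_ _ lz]; exists l. Qed.

Lemma expansion1_gt0 (R : realType) (beta : nat -> R) :
  (forall n, 1 < beta n) -> (0 < expansion beta 1 0)%N.
Proof.
by move=> b1; rewrite /expansion /= mulr1 truncn_gt0 ltW.
Qed.

Lemma quasi_greedy_approx_stable (R : realType) (beta : nat -> R) k k' n :
  (forall i, 1 < beta i) -> (n < k)%N -> (n < k')%N ->
  quasi_greedy_approx k beta n = quasi_greedy_approx k' beta n.
Proof.
elim: k k' beta n => [//|k IH] [//|k'] beta n b1 nk nk' /=.
case: asboolP => // fin.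
have [l hl] := finite_has_length (expansion1_gt0 b1) fin.
rewrite (word_lengthE hl); case: hl => l0 _ _.
case: ltngtP => // ln.
have {}ln : (l <= n)%N by rewrite -(prednK l0).
apply: IH => [i||]; first exact: b1.
- by apply: (@leq_trans n) => //; rewrite ltn_subrL l0 (leq_trans l0).
- by apply: (@leq_trans n) => //; rewrite ltn_subrL l0 (leq_trans l0).
Qed.

Lemma quasi_greedy_infinite (R : realType) (beta : nat -> R) :
  ~ finite_word (expansion beta 1) -> quasi_greedy beta = expansion beta 1.
Proof.
by move=> inf; apply/funext => n; rewrite /quasi_greedy /=; case: asboolP.
Qed.

Lemma quasi_greedy_finite (R : realType) (beta : nat -> R) l :
  cantor_base beta -> has_length (expansion beta 1) l ->
  quasi_greedy beta = fun n =>
    if (n < l.-1)%N then expansion beta 1 n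
    else if n == l.-1 then (expansion beta 1 l.-1).-1
    else quasi_greedy (shiftn l beta) (n - l).
Proof.
move=> [b1 _] hl; apply/funext => n; rewrite {1}/quasi_greedy /=.
case: asboolP => [_|]; last by case; exact: has_length_finite hl.
rewrite (word_lengthE hl); case: hl => l0 _ _.
case: ltngtP => // [ln|-> //].
have {}ln : (l <= n)%N by rewrite -(prednK l0).
apply: quasi_greedy_approx_stable => // [i|]; first exact: b1.
by rewrite ltn_subrL l0 (leq_trans l0).
Qed.

(* Main.v *)
(* Removing the first n digits of the expansion of x in base beta leaves the
   expansion of the n-th remainder in base beta^(n). For the direct implication
   it thus suffices to compare the expansion of a single y < 1 with the
   quasi-greedy expansion of 1. If they agree on infinitely many blocks of the
   recursion, then 1 - r_L = beta_0 ... beta_(L-1) (1 - y) at arbitrarily late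
   block ends L, where r_L is the remainder of y: the right side is unbounded,
   the left side is at most 1.

   Conversely, every finite prefix of the quasi-greedy expansion of 1 has value
   less than 1, and a word that is lexicographically smaller from position m on,
   and whose later tails have value at most 1, has value at most that of the
   prefix of length m + 1. Hence all tails of a have value less than 1, so that
   they are the remainders produced by the greedy algorithm on the value of a. *)

Require Import Defs.
From HB Require Import structures.
From mathcomp Require Import all_boot all_order all_algebra.
From mathcomp Require Import all_classical all_reals all_analysis.
From mathcomp Require Import ring lra.

Set Implicit Arguments.
Unset Strict Implicit.
Unset Printing Implicit Defensive.

Import Order.TTheory GRing.Theory Num.Theory.
Import numFieldNormedType.Exports.

Local Open Scope classical_set_scope.
Local Open Scope ring_scope.

(** * Shifted words and shifted Cantor bases *)

Lemma shiftnD (T : Type) (m n : nat) (u : nat -> T) :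
  shiftn n (shiftn m u) = shiftn (m + n) u.
Proof. by apply/funext => i; rewrite /shiftn addnA. Qed.

Lemma lex_lt_shiftn (u v : nat -> nat) (n : nat) :
  (forall i, (i < n)%N -> u i = v i) -> lex_lt (shiftn n u) (shiftn n v) ->
  lex_lt u v.
Proof.
move=> uv [m [eqm ltm]]; exists (n + m)%N; split=> // i.
case: (ltnP i n) => [/uv //|ni]; rewrite -{1}(subnKC ni) ltn_add2l => /eqm.
by rewrite /shiftn subnKC.
Qed.

Section CantorBase.
Variable R : realType.
Implicit Types (beta : nat -> R) (x y : R) (a w : nat -> nat).

Lemma base_prod_gt0 beta n :
  (forall i, 1 < beta i) -> 0 < \prod_(i < n) beta i.
Proof. by move=> b1; apply: prodr_gt0 => i _; apply: lt_trans (b1 i). Qed.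

Lemma base_prodD beta m n :
  \prod_(i < m + n) beta i =
  (\prod_(i < m) beta i) * \prod_(i < n) shiftn m beta i.
Proof. by rewrite big_split_ord. Qed.

Lemma cantor_base_shiftn beta n : cantor_base beta -> cantor_base (shiftn n beta).
Proof.
move=> [b1 /cvgryPge binf]; split=> [i|]; first exact: b1.
apply/cvgryPge => A.
have [N _ hN] := binf (A * \prod_(i < n) beta i).
exists N => // k /= Nk; have := hN (n + k)%N (leq_trans Nk (leq_addl _ _)).
by rewrite /= base_prodD mulrC ler_pM2l ?base_prod_gt0.
Qed.

Lemma base_prod_unbounded beta x :
  cantor_base beta -> 0 < x ->
  exists N, forall n, (N <= n)%N -> 1 < (\prod_(i < n) beta i) * x.
Proof.
(* The threshold [2 / x] instead of [1 / x] makes the final inequality strict. *)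
move=> [_ /cvgryPge binf] x0; have [N _ hN] := binf (2 / x).
exists N => n /hN /=; rewrite ler_pdivrMr // => h.
by apply: lt_le_trans h; rewrite ltr1n.
Qed.

(** * Remainders and digits of the greedy algorithm *)

Lemma remainder_shiftn beta x n k :
  remainder (shiftn n beta) (remainder beta x n) k = remainder beta x (n + k).
Proof. by elim: k => [|k IH]; rewrite ?addn0 // addnS /= IH. Qed.

Lemma expansion_shiftn beta x n :
  shiftn n (expansion beta x) =
  expansion (shiftn n beta) (remainder beta x n).
Proof. by apply/funext => k; rewrite /expansion remainder_shiftn. Qed.

Lemma remainder_ge0 beta x n : 0 <= x -> 0 <= remainder beta x n.
Proof. by case: n => [//|n] _; rewrite /= subr_ge0 floor_le_tmp. Qed.

Lemma remainder_lt1 beta x n : x < 1 -> remainder beta x n < 1.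
Proof.
by case: n => [//|n] _; rewrite /= ltrBlDl -[1]/(1%:~R) -intrD floorD1_gt.
Qed.

Lemma remainder_le1 beta x n : x <= 1 -> remainder beta x n <= 1.
Proof.
by case: n => [//|n] _; rewrite ltW //= ltrBlDl -[1]/(1%:~R) -intrD floorD1_gt.
Qed.

Lemma remainderS beta x n : (forall i, 1 < beta i) -> 0 <= x ->
  remainder beta x n.+1 =
  beta n * remainder beta x n - (expansion beta x n)%:R.
Proof.
move=> b1 x0 /=; rewrite /expansion truncn_floor.
have y0 : 0 <= beta n * remainder beta x n.
  by rewrite mulr_ge0 ?remainder_ge0 // ltW // (lt_trans _ (b1 n)).
by rewrite y0 natr_absz ger0_norm // floor_ge0.
Qed.

Lemma remainder0 beta n : remainder beta 0 n = 0.
Proof. by elim: n => // n IH; rewrite /= IH mulr0 floor0 subr0. Qed.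

Lemma expansion0 beta n : expansion beta 0 n = 0%N.
Proof. by rewrite /expansion remainder0 mulr0 truncn0. Qed.

(** As long as the digits agree, a greedy step subtracts the same integer on both sides and only
    scales the difference by [beta n]. *)
Lemma remainder_sub beta x y n : (forall i, 1 < beta i) -> 0 <= x -> 0 <= y ->
  (forall i, (i < n)%N -> expansion beta y i = expansion beta x i) ->
  remainder beta x n - remainder beta y n = (\prod_(i < n) beta i) * (x - y).
Proof.
move=> b1 x0 y0; elim: n => [|n IH] eqn; first by rewrite big_ord0 mul1r.
rewrite !remainderS // eqn // big_ord_recr /= mulrAC -IH; first lra.
by move=> i ni; rewrite eqn // ltnW.
Qed.

(** Comparison with the remainders of 0: if all digits vanish, the remainders of [x] are [x] times
    the unbounded products, yet they stay at most 1. *)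
Lemma expansion_eq0 beta x : cantor_base beta -> 0 <= x <= 1 ->
  (forall i, expansion beta x i = 0%N) -> x = 0.
Proof.
move=> cb /andP[x0 x1] e0; have [b1 _] := cb.
apply/eqP; rewrite eq_le x0 andbT leNgt; apply/negP => xgt0.
have [N /(_ N (leqnn _))] := base_prod_unbounded cb xgt0.
have := @remainder_sub beta x 0 N b1 x0 (lexx _).
rewrite remainder0 // !subr0 => <- => [|i _]; last by rewrite expansion0.
by rewrite ltNge remainder_le1.
Qed.

(** The remainder has only zero digits in the shifted base. *)
Lemma finite_expansion1_remainder beta l :
  cantor_base beta -> has_length (expansion beta 1) l ->
  remainder beta 1 l = 0.
Proof.
move=> cb [_ _ lz].
apply: (@expansion_eq0 (shiftn l beta)); first exact: cantor_base_shiftn.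
  by rewrite remainder_ge0 ?remainder_le1.
by move=> i; rewrite -expansion_shiftn /shiftn lz // leq_addr.
Qed.

Lemma remainder_eq0_digits beta x n :
  remainder beta x n = 0 ->
  forall i, (n <= i)%N -> expansion beta x i = 0%N.
Proof.
move=> rn i ni; rewrite -(subnKC ni).
rewrite -[LHS]/(shiftn n (expansion beta x) (i - n)%N).
by rewrite expansion_shiftn rn expansion0.
Qed.

(** * Comparison of expansions with the quasi-greedy expansion of 1 *)

Lemma quasi_greedy_shiftn beta l :
  cantor_base beta -> has_length (expansion beta 1) l ->
  shiftn l (quasi_greedy beta) = quasi_greedy (shiftn l beta).
Proof.
move=> cb hl; rewrite (quasi_greedy_finite cb hl); case: hl => l0 _ _.
apply/funext => n; rewrite /shiftn addKn.
have ln : (l.-1 < l + n)%N by rewrite prednK // leq_addr.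
by rewrite ltnNge (ltnW ln) /= gtn_eqF.
Qed.

(** At the first disagreement the remainder of 1 is the larger one, hence so is its digit. Without
    disagreement the gap [1 - y] would be scaled beyond 1. *)
Lemma expansion_lex_lt1 beta y : cantor_base beta -> 0 <= y < 1 ->
  lex_lt (expansion beta y) (expansion beta 1).
Proof.
move=> cb /andP[y0 y1]; have [b1 _] := cb.
have [|hne] := pselect (exists n, expansion beta y n != expansion beta 1 n).
  move/ex_minnP => [n ne nmin]; exists n.
  have eqn i : (i < n)%N -> expansion beta y i = expansion beta 1 i.
    by move=> ni; apply/eqP; apply: contraLR ni => /nmin; rewrite -leqNgt.
  split=> //; rewrite ltn_neqAle ne; apply: le_truncn.
  rewrite ler_pM2l ?(lt_trans _ (b1 n)) // -subr_ge0 remainder_sub //.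
  by rewrite mulr_ge0 ?ltW ?base_prod_gt0 ?subr_gt0.
have y1' : 0 < 1 - y by rewrite subr_gt0.
have [N /(_ N (leqnn _))] := base_prod_unbounded cb y1'.
rewrite -remainder_sub // => [h|i _]; last first.
  by apply: contra_notP hne => /eqP ne; exists i.
have := @remainder_le1 beta 1 N (lexx _); have := @remainder_ge0 beta y N y0.
lra.
Qed.

(** One block of the recursion: the strict comparison with [expansion beta 1] survives lowering the
    last digit of the block, unless [y] matches the whole lowered block. *)
Lemma expansion_lex_lt_block beta y : cantor_base beta -> 0 <= y < 1 ->
  lex_lt (expansion beta y) (quasi_greedy beta) \/
  exists l, [/\ (0 < l)%N,
    forall i, (i < l)%N -> expansion beta y i = quasi_greedy beta i,
    shiftn l (quasi_greedy beta) = quasi_greedy (shiftn l beta) &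
    1 - remainder beta y l = (\prod_(i < l) beta i) * (1 - y)].
Proof.
move=> cb y01; have [b1 _] := cb; have /andP[y0 y1] := y01.
have [n [eqn ltn]] := expansion_lex_lt1 cb y01.
have [fin|inf] := pselect (finite_word (expansion beta 1)); last first.
  by left; exists n; rewrite quasi_greedy_infinite.
have [l hl] := finite_has_length (expansion1_gt0 b1) fin.
have qgE := quasi_greedy_finite cb hl.
have [l0 el lz] := hl.
have nl : (n < l)%N by rewrite ltnNge; apply/negP => /lz e0; rewrite e0 in ltn.
have [nl1|nl1] := ltnP n l.-1.
  left; exists n; split=> [i ni|]; rewrite qgE ?nl1 //.
  by rewrite (ltn_trans ni nl1) eqn.
have nE : n = l.-1 by apply/eqP; rewrite eqn_leq nl1 andbT -ltnS prednK.
have eqqg i : (i < l.-1)%N -> expansion beta y i = quasi_greedy beta i.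
  by move=> il; rewrite qgE il eqn // nE.
have qgl : quasi_greedy beta l.-1 = (expansion beta 1 l.-1).-1.
  by rewrite qgE ltnn eqxx.
rewrite nE in ltn.
have : (expansion beta y l.-1 <= quasi_greedy beta l.-1)%N.
  by rewrite qgl -ltnS prednK.
rewrite leq_eqVlt => /predU1P[eql|ltl]; last by left; exists l.-1.
right; exists l; split=> // [i||].
- by rewrite -{1}(prednK l0) ltnS leq_eqVlt => /predU1P[->//|/eqqg].
- exact: quasi_greedy_shiftn.
(* The gap is scaled up to [l.-1]; the last step is done by hand, as there the digit of [y] is one
   less than that of 1. This unit turns the zero remainder of 1 at [l] into the 1 on the left-hand
   side. *)
have := @remainder_sub beta 1 y l.-1 b1 ler01 y0.
have := finite_expansion1_remainder cb hl.
rewrite -(prednK l0) !remainderS // eql qgl big_ord_recr /= => h1 h2.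
rewrite mulrAC -h2 => [|i il]; last by rewrite eqn // nE.
have := natrB R (leq_trans (ltn0Sn _) ltn); rewrite subn1; lra.
Qed.

Lemma expansion_lex_lt_quasi_greedy beta y : cantor_base beta -> 0 <= y < 1 ->
  lex_lt (expansion beta y) (quasi_greedy beta).
Proof.
move=> cb y01.
(* Blocks are nonempty, so [k] of them end at or after position [k]; their scaling factors
   multiply. *)
have key k : lex_lt (expansion beta y) (quasi_greedy beta) \/
    exists2 l, (k <= l)%N &
      1 - remainder beta y l = (\prod_(i < l) beta i) * (1 - y).
  elim: k beta y cb y01 => [|k IH] beta' y' cb y01.
    by right; exists 0%N; rewrite //= big_ord0 mul1r.
  have [|[l [l0 eql ql rl]]] := expansion_lex_lt_block cb y01; first by left.
  have /andP[y0 y1] := y01.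
  have r01 : 0 <= remainder beta' y' l < 1 by rewrite remainder_ge0 ?remainder_lt1.
  have [lt|[m km rm]] := IH _ _ (cantor_base_shiftn l cb) r01; [left|right].
    by apply: (lex_lt_shiftn eql); rewrite expansion_shiftn ql.
  exists (l + m)%N; first by rewrite -addn1 addnC leq_add.
  by rewrite -remainder_shiftn rm rl base_prodD mulrCA mulrA.
have /andP[y0 y1] := y01.
have y1' : 0 < 1 - y by rewrite subr_gt0.
have [N hN] := base_prod_unbounded cb y1'.
have [//|[l Nl rl]] := key N.
have := hN l Nl; rewrite -rl; have := @remainder_ge0 beta y l y0; lra.
Qed.

(** * Values of finite prefixes *)

Definition prefix_value beta a n : R :=
  \sum_(k < n) (a k)%:R / \prod_(i < k.+1) beta i.

Lemma prefix_valueS beta a n : prefix_value beta a n.+1 =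
  prefix_value beta a n + (a n)%:R / \prod_(i < n.+1) beta i.
Proof. by rewrite /prefix_value big_ord_recr. Qed.

Lemma prefix_valueD beta a m n : prefix_value beta a (m + n) =
  prefix_value beta a m +
  prefix_value (shiftn m beta) (shiftn m a) n / \prod_(i < m) beta i.
Proof.
rewrite /prefix_value big_split_ord /=; congr (_ + _).
rewrite mulr_suml; apply: eq_bigr => k _.
by rewrite -addnS base_prodD invfM mulrAC mulrA.
Qed.

Lemma eq_prefix_value beta a w n :
  (forall i, (i < n)%N -> a i = w i) ->
  prefix_value beta a n = prefix_value beta w n.
Proof. by move=> aw; apply: eq_bigr => i _; rewrite aw. Qed.

Lemma nondecreasing_prefix_value beta a : (forall i, 1 < beta i) ->
  {homo prefix_value beta a : m n / (m <= n)%N >-> m <= n}.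
Proof.
move=> b1 m n /subnKC <-; rewrite prefix_valueD lerDl.
rewrite divr_ge0 ?(ltW (base_prod_gt0 _ b1)) // sumr_ge0 // => k _.
by rewrite divr_ge0 // ltW // base_prod_gt0 // => i; apply: b1.
Qed.

(** Each digit accounts for the drop of the scaled remainder, so the sum telescopes. *)
Lemma prefix_value_expansion beta x n : (forall i, 1 < beta i) -> 0 <= x ->
  prefix_value beta (expansion beta x) n =
  x - remainder beta x n / \prod_(i < n) beta i.
Proof.
move=> b1 x0; elim: n => [|n IH].
  by rewrite /prefix_value !big_ord0 /= divr1 subrr.
rewrite prefix_valueS IH remainderS // big_ord_recr /=.
have p0 := lt0r_neq0 (base_prod_gt0 n b1).
have bn0 : beta n != 0 by rewrite gt_eqF // (lt_trans _ (b1 n)).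
by field; apply/andP.
Qed.

(** Strong induction on the length. Inside the first block a positive remainder of 1 is still
    missing; a complete block falls short of 1 by the inverse of its product, and what follows is
    worth less than that. *)
Lemma prefix_value_quasi_greedy_lt1 beta n :
  cantor_base beta -> prefix_value beta (quasi_greedy beta) n < 1.
Proof.
elim/ltn_ind: n beta => n IH beta cb; have [b1 _] := cb.
have ltP m : 0 < remainder beta 1 m ->
    prefix_value beta (expansion beta 1) m < 1.
  move=> r0; rewrite prefix_value_expansion //.
  by rewrite ltrBlDr ltrDl divr_gt0 ?base_prod_gt0.
(* A zero remainder would produce only zero digits. *)
have rP m : (exists2 i, (m <= i)%N & expansion beta 1 i != 0%N) ->
    0 < remainder beta 1 m.
  move=> [i mi ne]; rewrite lt_def remainder_ge0 // andbT.
  apply: contraNN ne => /eqP r0.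
  by rewrite (remainder_eq0_digits r0).
have [fin|inf] := pselect (finite_word (expansion beta 1)); last first.
  rewrite quasi_greedy_infinite //; apply/ltP/rP.
  apply: contra_notP inf => h; exists n => i ni.
  by apply: contra_notP h => /eqP ne; exists i.
have [l hl] := finite_has_length (expansion1_gt0 b1) fin.
have qgE := quasi_greedy_finite cb hl.
have [l0 el lz] := hl.
have pre m : (m < l)%N -> prefix_value beta (quasi_greedy beta) m =
    prefix_value beta (expansion beta 1) m.
  move=> ml; apply: eq_prefix_value => i im.
  by rewrite qgE (leq_trans im) // -ltnS prednK.
have [nl|ln] := ltnP n l.
  rewrite pre //; apply/ltP/rP; exists l.-1; first by rewrite -ltnS prednK.
  by rewrite -lt0n.
have qgl : prefix_value beta (quasi_greedy beta) l =
    1 - (\prod_(i < l) beta i)^-1.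
  have := prefix_value_expansion l b1 ler01.
  rewrite (finite_expansion1_remainder cb hl) mul0r subr0.
  rewrite -(prednK l0) !prefix_valueS pre ?prednK // => sum1.
  have := natrB R el; rewrite subn1 => predE.
  by rewrite qgE ltnn eqxx predE mulrBl div1r addrA sum1.
rewrite -(subnKC ln) prefix_valueD qgl (quasi_greedy_shiftn cb hl).
have := IH (n - l)%N _ (shiftn l beta) (cantor_base_shiftn l cb).
rewrite ltn_subrL l0 (leq_trans l0 ln) => /(_ isT) lt1.
rewrite -addrA gtrDl addrC subr_lt0 -[ltRHS]mul1r.
by rewrite ltr_pM2r // invr_gt0 base_prod_gt0.
Qed.

(** The digit at [m] is smaller by at least one unit, which pays for the whole tail after it. Tails
    are bounded only for lengths below [n], so that the lemma can serve in an induction on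
    length. *)
Lemma prefix_value_lex_le beta a w m n : (forall i, 1 < beta i) ->
  (forall i, (i < m)%N -> a i = w i) -> (a m < w m)%N ->
  (forall k, (k < n)%N ->
    prefix_value (shiftn m.+1 beta) (shiftn m.+1 a) k <= 1) ->
  prefix_value beta a n <= prefix_value beta w m.+1.
Proof.
move=> b1 eqm ltm tail; have [nm|mn] := leqP n m.
  rewrite (@eq_prefix_value _ _ w) => [|i im].
    by apply: nondecreasing_prefix_value => //; apply: leqW.
  by rewrite eqm // (leq_trans im).
rewrite -(subnKC mn) prefix_valueD !prefix_valueS (eq_prefix_value _ eqm).
rewrite -addrA lerD2l -mulrDl ler_pM2r ?invr_gt0 ?base_prod_gt0 //.
have := tail (n - m.+1)%N; rewrite ltn_subrL /= (leq_trans _ mn) // => /(_ isT).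
have : (a m).+1%:R <= (w m)%:R :> R by rewrite ler_nat.
by rewrite -natr1; lra.
Qed.

End CantorBase.

(** * Both directions of the lexicographic criterion *)

Theorem theorem26 (R : realType) (beta : nat -> R) (hbeta : cantor_base beta)
    (a : nat -> nat) :
  expansions beta a <->
  forall n : nat, lex_lt (shiftn n a) (quasi_greedy (shiftn n beta)).
Proof.
have [b1 _] := hbeta; split=> [[x /= /andP[x0 x1] <-] n|lex].
  rewrite expansion_shiftn; apply: expansion_lex_lt_quasi_greedy.
    exact: cantor_base_shiftn.
  by rewrite remainder_ge0 ?remainder_lt1.
pose v n := prefix_value (shiftn n beta) (shiftn n a).
have b1s n i : 1 < shiftn n beta i by exact: b1.
(* The bound [c] does not depend on [N], so that strictness survives the passage to the limit. *)
have tight n : exists2 c : R, c < 1 &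
    forall N, (forall m k, (k < N)%N -> v m k <= 1) -> v n N <= c.
  have [m [eqm ltm]] := lex n.
  exists (prefix_value (shiftn n beta) (quasi_greedy (shiftn n beta)) m.+1).
    by apply: prefix_value_quasi_greedy_lt1; apply: cantor_base_shiftn.
  move=> N vN; apply: prefix_value_lex_le => // k kN.
  by rewrite !shiftnD; apply: vN.
(* Induction on the length for all tails at once: the bound for one tail rests on shorter prefixes
   of later tails. *)
have v1 N : forall n, v n N <= 1.
  elim/ltn_ind: N => N IH n; have [c c1 vc] := tight n.
  by apply: le_trans (vc N _) (ltW c1) => m k /IH.
have vmono n := nondecreasing_prefix_value (shiftn n a) (b1s n).
have vcvg n : cvgn (v n).
  apply: nondecreasing_is_cvgn; first exact: vmono.
  by exists 1 => _ [N _ <-].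
pose s n : R := limn (v n).
have s01 n : 0 <= s n < 1.
  apply/andP; split.
    apply: limr_ge => //; exists 0%N => // N _.
    have := vmono n 0%N N (leq0n _).
    by rewrite [X in X <= _ -> _]big_ord0.
  have [c c1 vc] := tight n; apply: le_lt_trans c1.
  by apply: limr_le => //; exists 0%N => // N _; apply: vc.
(* The limits satisfy the greedy recursion with digits [a n], by splitting off the first letter of
   each prefix. *)
have srec n : beta n * s n = (a n)%:R + s n.+1.
  have bn0 : beta n != 0 by rewrite gt_eqF // (lt_trans _ (b1 n)).
  have vS k : v n k.+1 = ((a n)%:R + v n.+1 k) / beta n.
    rewrite /v -add1n prefix_valueD !shiftnD addn1 /prefix_value.
    by rewrite !big_ord_recl !big_ord0 mulr1 addr0 /shiftn addn0 mulrDl.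
  suff -> : s n = ((a n)%:R + s n.+1) / beta n by rewrite mulrC divfK.
  apply: cvg_lim => //; rewrite -cvg_shiftS /=.
  under eq_fun do rewrite vS.
  by apply: cvgMl; apply: cvgD; [exact: cvg_cst | exact: vcvg].
(* Since [s n.+1] lies in [0, 1), it is the fractional part and [a n] the integer part. *)
have dig n : Num.truncn (beta n * s n) = a n.
  apply: truncn_def; rewrite srec -natr1; have := s01 n.+1; lra.
have /andP[s00 s01'] := s01 0%N.
have rem n : remainder beta (s 0%N) n = s n.
  elim: n => // n IH; rewrite remainderS // /expansion IH dig srec; lra.
by exists (s 0%N); [exact: s01 | apply/funext => n; rewrite /expansion rem dig].
Qed.
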